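(* Let $n\ge 1$ and $w\in S_n$. Then $P_w(q)=R_w(q)$ if and only if $w$ avoids the two patterns $3412$ and $4231$ (i.e., $w$ is a smooth permutation).
   Context: For $w\in S_n$, $\ell(w)$ is the number of inversions of $w$, and $\le$ denotes the (strong) Bruhat order on $S_n$, the partial order generated by the relations $w<w\cdot t_{ij}$ whenever $\ell(w)<\ell(w\cdot t_{ij})$, where $t_{ij}$ is the transposition of $i$ and $j$. Define $P_w(q)=\sum_{u\in S_n,\,u\le w} q^{\ell(u)}$ (the Poincaré polynomial of the Schubert variety $X_w$). The inversion graph $G_w$ is the graph on vertex set $\{1,\dots,n\}$ with edges $\{i,j\}$ for all $1\le i<j\le n$ with $w(i)>w(j)$. For a graph $G$ on $\{1,\dots,n\}$ and an acyclic orientation $\mathcal{O}$ of $G$, let $\mathrm{des}(\mathcal{O})$ be the number of edges oriented $i\to j$ with $i>j$; set $R_G(q)=\sum_{\mathcal{O}} q^{\mathrm{des}(\mathcal{O})}$, summing over all acyclic orientations of $G$. Equivalently, $R_G(q)=\sum_r q^{d(r,r_0)}$ over the regions $r$ of the graphical arrangement of hyperplanes $x_i-x_j=0$ ($\{i,j\}$ an edge of $G$) in $\mathbb{R}^n$, where $r_0$ is the region containing $(1,2,\dots,n)$ and $d(r,r_0)$ is the number of hyperplanes separating $r$ and $r_0$. Set $R_w(q)=R_{G_w}(q)$. A permutation $w$ contains a pattern $\sigma\in S_k$ if some subsequence of $k$ entries of $w(1)\cdots w(n)$ has the same relative order as $\sigma$; it avoids $\sigma$ otherwise. *)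

(* Defs.v *)
From HB Require Import structures.
From mathcomp Require Import all_boot all_order all_fingroup all_algebra.

Set Implicit Arguments.
Unset Strict Implicit.
Unset Printing Implicit Defensive.

Local Open Scope nat_scope.

(* The set {1, ..., n} is 'I_n, shifted to {0, ..., n-1}, and S_n is 'S_n. *)

Definition inversions (n : nat) (w : 'S_n) : {set 'I_n * 'I_n} :=
  [set p : 'I_n * 'I_n | (p.1 < p.2) && (w p.2 < w p.1)].

Definition ell (n : nat) (w : 'S_n) : nat := #|inversions w|.

(* MathComp composes permutations left to right, (s * t) x = t (s x), so the
   right-to-left product w . t_ij, which maps x to w (t_ij x), is
   (tperm i j * w)%g. The case i = j is excluded by the length condition. *)
Definition bruhat_step (n : nat) : rel 'S_n := fun u v =>
  [exists i : 'I_n, exists j : 'I_n,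
     (v == (tperm i j * u)%g) && (ell u < ell v)].

Definition bruhat_le (n : nat) : rel 'S_n := connect (@bruhat_step n).

Definition poincare (n : nat) (w : 'S_n) : {poly int} :=
  (\sum_(u : 'S_n | bruhat_le u w) 'X^(ell u))%R.

Definition inversion_graph (n : nat) (w : 'S_n) : rel 'I_n := fun i j =>
  ((i < j) && (w j < w i)) || ((j < i) && (w i < w j)).

Lemma inversion_graph_sym (n : nat) (w : 'S_n) :
  symmetric (inversion_graph w).
Proof. by move=> i j; rewrite /inversion_graph orbC. Qed.

Lemma inversion_graph_irr (n : nat) (w : 'S_n) :
  irreflexive (inversion_graph w).
Proof. by move=> i; rewrite /inversion_graph !ltnn. Qed.

(* A simple graph is a symmetric irreflexive relation. An orientation is the
   set of its arcs, (i, j) standing for the edge {i, j} oriented i -> j. *)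
Definition has_arc (n : nat) (O : {set 'I_n * 'I_n}) : rel 'I_n := fun i j => (i, j) \in O.

Definition is_orientation (n : nat) (G : rel 'I_n) (O : {set 'I_n * 'I_n}) : bool :=
  [forall i : 'I_n, forall j : 'I_n,
     if G i j then has_arc O i j (+) has_arc O j i else ~~ has_arc O i j].

(* Some directed cycle exists iff some arc i -> j is closed up by a directed
   path from j back to i; see acyclicP. *)
Definition acyclic (n : nat) (O : {set 'I_n * 'I_n}) : bool :=
  [forall i : 'I_n, forall j : 'I_n, has_arc O i j ==> ~~ connect (has_arc O) j i].

Lemma acyclicP (n : nat) (O : {set 'I_n * 'I_n}) :
  reflect (forall c : seq 'I_n, path.cycle (has_arc O) c -> c = [::]) (acyclic O).
Proof.
apply: (iffP idP) => [acO [|x p] //= cyc|noc].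
- have [y [q def_q]] : exists y q, rcons p x = y :: q.
    by case: p {cyc} => [|y q]; [exists x, [::] | exists y, (rcons q x)].
  move: cyc; rewrite def_q /= => /andP[xy yq].
  move/forallP/(_ x)/forallP/(_ y)/implyP/(_ xy)/negP: acO; case.
  apply/connectP; exists q => //.
  have := congr1 (last x) def_q.
  by rewrite last_rcons.
- apply/forallP=> i; apply/forallP=> j; apply/implyP=> ij.
  apply/negP => /connectP[p jp def_i].
  suff /noc : path.cycle (has_arc O) (j :: p) by [].
  by rewrite /= rcons_path jp -def_i.
Qed.

Definition des (n : nat) (O : {set 'I_n * 'I_n}) : nat :=
  #|[set a in O | a.2 < a.1]|.

Definition acyclic_orientation_poly (n : nat) (G : rel 'I_n) : {poly int} :=
  (\sum_(O : {set 'I_n * 'I_n} | is_orientation G O && acyclic O)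
     'X^(des O))%R.

Definition inversion_poly (n : nat) (w : 'S_n) : {poly int} :=
  acyclic_orientation_poly (inversion_graph w).

(* f lists the positions of the subsequence. *)
Definition contains_pattern (n k : nat) (w : 'S_n) (sigma : 'S_k) : Prop :=
  exists f : 'I_k -> 'I_n,
    (forall a b : 'I_k, a < b -> f a < f b) /\
    (forall a b : 'I_k, (w (f a) < w (f b)) = (sigma a < sigma b)).

Definition avoids_pattern (n k : nat) (w : 'S_n) (sigma : 'S_k) : Prop :=
  ~ contains_pattern w sigma.

Definition word4 (s : seq nat) : 'I_4 -> 'I_4 :=
  fun i => inord (nth 0 s i).-1.

Lemma word4_inj (s : seq nat) :
  perm_eq s [:: 1; 2; 3; 4] -> injective (word4 s).
Proof.
move=> ps i j /(congr1 val).
have ss : size s = 4 by rewrite (perm_size ps).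
have rg (k : 'I_4) : 0 < nth 0 s k < 5.
  have : nth 0 s k \in s by rewrite mem_nth ?ss.
  rewrite (perm_mem ps) !inE.
  by case/or4P => /eqP->.
have [/andP[i0 i5] /andP[j0 j5]] := (rg i, rg j).
rewrite /= !inordK ?prednK //.
move/(congr1 succn); rewrite !prednK // => /eqP.
rewrite nth_uniq ?ss // ?(perm_uniq ps) // => /eqP.
exact: val_inj.
Qed.

Definition p3412 : 'S_4 := perm (@word4_inj [:: 3; 4; 1; 2] isT).
Definition p4231 : 'S_4 := perm (@word4_inj [:: 4; 2; 3; 1] isT).

(* Main.v *)
Require Import Defs.
From mathcomp Require Import all_boot all_order all_fingroup all_algebra.
From mathcomp Require Import zify.

Set Implicit Arguments.
Unset Strict Implicit.
Unset Printing Implicit Defensive.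

(** The Bruhat order is given by a rank criterion: [u <= w] iff, for all [p] and
    [q], at most as many of the first [p] values of [u] as of [w] are [>= q].

    If [P_w = R_w], reversing all arcs shows that [R_w], hence [P_w], is
    palindromic of degree [ell w], so the average length in [[e, w]] is
    [ell w / 2]. That average is half the average degree in the Bruhat graph on
    [[e, w]], where [u] is joined to [u t] for each transposition [t]. Along an
    edge [u < u t <= w] the degree cannot grow: compare the edges [t'] commuting
    with [t] one by one, and the others inside cosets of the copies of [S_3]
    containing [t]. As the degree at [w] is [ell w], every degree is at least
    [ell w], so all are equal; but a pattern 3412 or 4231 in [w] produces an edge
    along which the degree drops.

    Conversely, if [w] avoids both patterns, then [w] or its inverse is decreasing
    to the right of its maximal value, sitting at position [d], say. Deleting that
    value divides both [P_w] and [R_w] by [1 + q + ... + q^(n - d)]: a vertex whose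
    neighbours are larger and form a clique can be inserted anywhere in their
    total order. Inversion changes neither polynomial. *)

(** * Rank criterion for the Bruhat order *)

Definition rk (n : nat) (f : 'I_n -> 'I_n) (p q : nat) : nat :=
  \sum_(a < n) ((a < p) && (q <= f a)).

Definition rle (n : nat) (f g : 'I_n -> 'I_n) : Prop :=
  forall p q, rk f p q <= rk g p q.

Lemma rk_split n (s : seq 'I_n) (f : 'I_n -> 'I_n) p q : uniq s ->
  rk f p q = \sum_(a <- s) ((a < p) && (q <= f a))
           + \sum_(a < n | a \notin s) ((a < p) && (q <= f a)).
Proof. by move=> us; rewrite /rk (bigID (mem s)) /= -big_uniq. Qed.

(** The contributions outside [s] cancel; the identity is written with sums on both sides to avoid
    truncated subtraction. *)
Lemma rk_agree n (s : seq 'I_n) (f g : 'I_n -> 'I_n) p q : uniq s ->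
  {in [predC s], f =1 g} ->
  rk f p q + \sum_(a <- s) ((a < p) && (q <= g a)) =
  rk g p q + \sum_(a <- s) ((a < p) && (q <= f a)).
Proof.
move=> us fg; rewrite !(rk_split _ _ _ us).
have E : \sum_(a < n | a \notin s) ((a < p) && (q <= f a))
  = \sum_(a < n | a \notin s) ((a < p) && (q <= g a)).
  by apply: eq_bigr => a na; rewrite fg.
by rewrite E addnAC [RHS]addnAC; congr (_ + _); exact: addnC.
Qed.

Lemma tperm_actE n (i j x : 'I_n) (u : 'S_n) :
  (tperm i j * u)%g x = if x == i then u j else if x == j then u i else u x.
Proof.
rewrite permM; case: tpermP => [->|->|/eqP/negPf-> /eqP/negPf->] //.
  by rewrite eqxx.
by rewrite eqxx; case: eqVneq => // ->.
Qed.

(** [phi] injects the inversions of [u] into those of the product: it transports a pair by the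
    transposition when its order survives and keeps it otherwise. The pair [(i, j)] is an inversion
    outside the image. *)
Lemma ell_tperm n (i j : 'I_n) (u : 'S_n) :
  i < j -> u i < u j -> ell u < ell (tperm i j * u)%g.
Proof.
move=> ij uij; pose t := tperm i j; pose v := (t * u)%g.
have tE x : t x = if x == i then j else if x == j then i else x.
  by rewrite -[t]mulg1 tperm_actE !perm1.
pose phi (p : 'I_n * 'I_n) := if t p.1 < t p.2 then (t p.1, t p.2) else p.
have tK : involutive t by move=> x; rewrite /t tpermK.
have phi_inj : {in inversions u &, injective phi}.
  move=> [x y] [x' y']; rewrite !inE /phi /= => /andP[xy _] /andP[xy' _].
  case: (boolP (t x < t y)) => h; case: (boolP (t x' < t y')) => h' [].
  - by move=> /perm_inj-> /perm_inj->.
  - by move=> e1 e2; move: h'; rewrite -e1 -e2 !tK xy.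
  - by move=> e1 e2; move: h; rewrite e1 e2 !tK xy'.
  - by move=> -> ->.
rewrite /ell -(card_in_imset phi_inj); apply: proper_card; apply/properP; split.
  apply/subsetP => z /imsetP[[x y]]; rewrite inE /phi /= => /andP[xy uyx] {z}->.
  case: ifP => [h|/negbT]; first by rewrite inE /= h !permM !tK.
  rewrite inE /= xy !tperm_actE !tE.
  case: (eqVneq x i) => [?|xi]; first (subst x; case: (eqVneq y i) => [?|yi]).
  - by subst; lia.
  - by case: (eqVneq y j) => [?|yj]; [subst|]; lia.
  case: (eqVneq y i) => [?|yi]; first subst y.
    by case: (eqVneq x j) => [?|yj]; [subst|]; lia.
  case: (eqVneq x j) => [?|xj]; first subst x.
    by case: (eqVneq y j) => [?|yj]; [subst|]; lia.
  by case: (eqVneq y j) => [?|yj]; [subst|]; lia.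
exists (i, j); first by rewrite inE /= ij !tperm_actE !eqxx; case: eqVneq => // ?; subst; lia.
apply/imsetP => -[[x y]]; rewrite inE /phi /= => /andP[xy uyx].
case: ifP => [h [ei ej]|_ [ei ej]]; last by move: uyx; rewrite -ei -ej; lia.
move: xy; have -> : x = j by rewrite -[x]tK -ei tE eqxx.
have -> : y = i by rewrite -[y]tK -ej tE eqxx; case: eqVneq => // ->.
by lia.
Qed.

Lemma rk_tperm n (i j : 'I_n) (u : 'S_n) p q : i < j -> u i < u j ->
  rk (tperm i j * u)%g p q = rk u p q + ((i < p <= j) && (u i < q <= u j)).
Proof.
move=> ij uij; have us : uniq [:: i; j] by rewrite /= inE andbT -val_eqE /=; lia.
have := @rk_agree _ [:: i; j] u (tperm i j * u)%g p q us.
rewrite !big_cons !big_nil !tperm_actE !eqxx.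
have /negPf-> : j != i by rewrite -val_eqE /=; lia.
move=> E.
suff: rk u p q + (((i < p) && (q <= u j)) + ((j < p) && (q <= u i)))
  = rk (tperm i j * u)%g p q + (((i < p) && (q <= u i)) + ((j < p) && (q <= u j))).
  clear E us; move: (rk u p q) (rk _ p q); move: (u i) (u j) uij => a b ab x y H; lia.
rewrite -[X in _ + X]addn0 -[X in _ = _ + X]addn0 -!addnA; apply: E => x.
by rewrite !inE negb_or => /andP[/negPf h1 /negPf h2]; rewrite tperm_actE h1 h2.
Qed.

Lemma rle_trans n (g f h : 'I_n -> 'I_n) : rle f g -> rle g h -> rle f h.
Proof. by move=> fg gh p q; apply: leq_trans (gh p q). Qed.

Lemma rle_tperm n (i j : 'I_n) (u : 'S_n) :
  i < j -> u i < u j -> rle u (tperm i j * u)%g.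
Proof. by move=> ij uij p q; rewrite rk_tperm // leq_addr. Qed.

Lemma tperm_mulK n (i j : 'I_n) (u : 'S_n) : (tperm i j * (tperm i j * u))%g = u.
Proof. by rewrite mulgA tperm2 mul1g. Qed.

Lemma tperm_mul_lt n (i j : 'I_n) (u : 'S_n) :
  u j < u i -> (tperm i j * u)%g i < (tperm i j * u)%g j.
Proof. by rewrite !permM tpermL tpermR. Qed.

Lemma bruhat_step_tperm n (i j : 'I_n) (u : 'S_n) :
  i < j -> u i < u j -> bruhat_step u (tperm i j * u)%g.
Proof.
move=> ij uij; apply/existsP; exists i; apply/existsP; exists j.
by rewrite eqxx ell_tperm.
Qed.

Lemma bruhat_stepP n (u v : 'S_n) :
  bruhat_step u v ->
  exists i j : 'I_n, [/\ i < j, u i < u j & v = (tperm i j * u)%g].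
Proof.
case/existsP => i /existsP[j /andP[/eqP vE lt]].
wlog ij : i j vE / i < j => [H|].
  case: (ltngtP i j) => [h|h|/val_inj h]; first exact: (H i j).
  - by apply: (H j i) => //; rewrite tpermC.
  - by move: lt; rewrite vE h tperm1 mul1g ltnn.
exists i, j; split=> //.
case: (ltngtP (u i) (u j)) => // [h|/val_inj/perm_inj h]; last by rewrite h ltnn in ij.
have := ell_tperm ij (tperm_mul_lt h).
by rewrite tperm_mulK -vE ltnNge ltnW.
Qed.

Lemma rk_window n (f : 'I_n -> 'I_n) p q m : q <= m ->
  rk f p q = rk f p m + \sum_(a < n) ((a < p) && (q <= f a < m)).
Proof.
by move=> qm; rewrite /rk -big_split /=; apply: eq_bigr => a _; lia.
Qed.

(** Take [i] the first position where [u] and [w] differ, and [j] the first later position whose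
    value in [u] lies above [u i] and at most at [w i]. *)
Lemma rle_neq_step n (u w : 'S_n) : rle u w -> u != w ->
  exists i j : 'I_n, [/\ i < j, u i < u j & rle (tperm i j * u)%g w].
Proof.
move=> uw neq.
have [i0 di0] : exists i, u i != w i.
  apply/existsP; apply: contraR neq; rewrite negb_exists => /forallP h.
  by apply/eqP/permP => a; apply/eqP; have := h a; rewrite negbK.
case: (@arg_minnP _ i0 (fun a => u a != w a) (@nat_of_ord n) di0) => i di imin.
have same (a : 'I_n) : a < i -> u a = w a.
  by move=> ai; apply/eqP; apply: contraTT ai => /imin; rewrite -leqNgt.
(* Otherwise the rank at [p = i.+1], [q = u i] would be larger for [u]: the earlier values agree and
   only [u] scores at [i]. *)
have uiwi : u i < w i.
  rewrite ltn_neqAle val_eqE di leqNgt; apply/negP => wu.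
  have := uw i.+1 (u i); rewrite /rk (bigD1 i) //= [X in _ <= X](bigD1 i) //=.
  rewrite (eq_bigr (fun a : 'I_n => nat_of_bool ((a < i.+1) && (u i <= w a)))).
    by rewrite ltnS !leqnn (leqNgt (u i)) wu /= !add0n; lia.
  move=> a ai; case: (ltnP a i.+1) => //= ai1; rewrite (same a) //.
  by rewrite ltn_neqAle val_eqE ai.
pose P (j : 'I_n) := [&& i < j, u i < u j & u j <= w i].
(* The position of the value [w i] in [u] is a candidate: it comes after [i], since [u] and [w]
   agree before [i] and differ there. *)
have Pj0 : P ((u^-1)%g (w i)).
  rewrite /P permKV leqnn uiwi !andbT ltnNge; apply/negP.
  rewrite leq_eqVlt => /orP[/eqP/val_inj h|h].
    by move: di; rewrite -[in u i]h permKV eqxx.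
  by move: (same _ h) (h); rewrite permKV => /perm_inj <-; rewrite ltnn.
case: (@arg_minnP _ _ P (@nat_of_ord n) Pj0) => j /and3P[ij uij ujw] jmin.
exists i, j; split=> // p q; rewrite rk_tperm //.
case: (boolP (_ && _)) => [/andP[/andP[ip pj] /andP[uiq quj]]|_]; last by rewrite addn0.
(* Split the counts at the value [w i]. Above it the hypothesis applies; in the window from [q] to
   [w i], position [i] counts for [w] only, and by minimality of [j] no position of [u] strictly
   between [i] and [p] counts. *)
have qM : q <= (w i).+1 by lia.
rewrite addn1 !(rk_window _ _ qM) -addnS leq_add //.
rewrite (bigD1 i) //= [X in _ <= X](bigD1 i) //= ip ltnS leqnn andbT.
rewrite (leqNgt q (u i)) uiq (leq_trans quj ujw) /= add0n add1n ltnS.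
apply: leq_sum => a ai; case: (ltngtP a i) => [h|h|/val_inj h].
- by rewrite same.
- case: (ltnP a p) => //= ap; case: (boolP (_ <= _ < _)) => // /andP[h1 h2].
  suff /jmin : P a by lia.
  by rewrite /P h; lia.
- by rewrite h eqxx in ai.
Qed.

(** A Bruhat step lowers no rank. Conversely, [rle_neq_step] lengthens [u] while keeping it below
    [w]; lengths are bounded by the number of pairs, so the climb ends at [w]. *)
Lemma bruhat_leP n (u w : 'S_n) : reflect (rle u w) (bruhat_le u w).
Proof.
apply: (iffP idP) => [/connectP[s]|].
  elim: s u => [u _ -> //|v s IH u /= /andP[/bruhat_stepP[i [j [ij uij vE]]] vs ws]].
  by apply: (@rle_trans _ v); [rewrite vE; apply: rle_tperm | apply: IH].
have bound (v : 'S_n) : ell v <= #|{: 'I_n * 'I_n}| by apply: max_card.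
have [k] := ubnP (#|{: 'I_n * 'I_n}| - ell u).
elim: k u => // k IH u ltk uw.
have [->|neq] := eqVneq u w; first exact: connect0.
have [i [j [ij uij tw]]] := rle_neq_step uw neq.
apply: (connect_trans (connect1 (bruhat_step_tperm ij uij))).
apply: IH tw; have := ell_tperm ij uij; have := bound (tperm i j * u)%g.
by lia.
Qed.

Lemma bruhat_le_refl n (w : 'S_n) : bruhat_le w w.
Proof. exact: connect0. Qed.

Lemma bruhat_le_tperm n (i j : 'I_n) (u w : 'S_n) :
  i < j -> u i < u j -> bruhat_le (tperm i j * u)%g w -> bruhat_le u w.
Proof.
by move=> ij uij; apply: connect_trans; apply: connect1; apply: bruhat_step_tperm.
Qed.

Lemma bruhat_le_tperm_down n (i j : 'I_n) (u w : 'S_n) :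
  i < j -> u j < u i -> bruhat_le u w -> bruhat_le (tperm i j * u)%g w.
Proof.
move=> ij uji; rewrite -{1}(tperm_mulK i j u); apply: bruhat_le_tperm => //.
exact: tperm_mul_lt.
Qed.

(** * Degrees in the Bruhat graph *)

Section ThreePositions.

Variables (r s : nat -> nat -> nat) (i j k : nat).

(** With [r] the contribution of all other positions and [s] the rank function of [w], this is the
    rank criterion for the element with values [x], [y], [z] at [i], [j], [k]. Position [k] may lie
    anywhere relative to [i < j]. *)
Definition fits (x y z : nat) : Prop := forall p q,
  r p q + (((i < p) && (q <= x)) + ((j < p) && (q <= y)) + ((k < p) && (q <= z))) <= s p q.

Lemma fits_ij x y z : i < j -> x < y -> fits y x z -> fits x y z.
Proof. by move=> ij xy H p q; have := H p q; lia. Qed.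

Lemma fits_kj x y z : k < j -> z < y -> fits x z y -> fits x y z.
Proof. by move=> ij xy H p q; have := H p q; lia. Qed.

Lemma fits_ik x y z : i < k -> x < z -> fits z y x -> fits x y z.
Proof. by move=> ij xy H p q; have := H p q; lia. Qed.

Variables a b c : nat.
Hypotheses (ij : i < j) (ab : a < b) (ki : k != i) (kj : k != j) (ca : c != a) (cb : c != b).
Hypothesis fits_bac : fits b a c.

(** Here [abc] is [u] and [bac] is [v], its product with the transposition of [i] and [j]; [cab] is
    a neighbour of [v], while [cba] and [acb] are neighbours of [u]. Mostly one of the latter is
    obtained by undoing an inversion; in the remaining case the ranks of [cab] and [bac] together
    bound those of [cba]. *)
Lemma fits_cab : fits c a b -> fits c b a \/ fits a c b.
Proof.
move=> H.
have [h|h|h] := ltngtP k i; [| | lia]; first by left; apply: fits_kj => //; lia.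
have [h'|h'|h'] := ltngtP k j; [| | lia]; first by left; apply: fits_kj.
have [h2|h2|h2] := ltngtP c a; [| | lia]; last by right; apply: fits_ij.
by left=> p q; have := H p q; have := fits_bac p q; lia.
Qed.

Lemma fits_bca : fits b c a -> fits c b a \/ fits a c b.
Proof.
move=> H.
have [h|h|h] := ltngtP k i; [| | lia]; last by right; apply: fits_ik.
have [h2|h2|h2] := ltngtP c b; [| | lia]; first by left; apply: fits_ij.
by left=> p q; have := H p q; have := fits_bac p q; lia.
Qed.

(* In the coset of [S_3], the top element is the join of the two elements of
   length 2: this is the property special to type A. *)
Lemma fits_cab_bca : fits c a b -> fits b c a -> fits c b a /\ fits a c b.
Proof.
move=> H1 H2; split=> p q; have := H1 p q; have := H2 p q; have := fits_bac p q; lia.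
Qed.

End ThreePositions.

Lemma leq_sum_strict (I : finType) (P : pred I) (F G : I -> nat) x :
  (forall y, P y -> F y <= G y) -> P x -> F x < G x ->
  \sum_(y | P y) F y < \sum_(y | P y) G y.
Proof.
move=> FG Px lt; rewrite (bigD1 x) //= [X in _ < X](bigD1 x) //= -addSn.
by apply: leq_add => //; apply: leq_sum => y /andP[/FG].
Qed.

Section BruhatDegree.

Variables (n : nat) (w : 'S_n).

(** Ordered pairs, diagonal included: for [u] below [w] this is twice the degree in the Bruhat graph
    plus [n]. *)
Definition bdeg (u : 'S_n) : nat :=
  \sum_(x < n) \sum_(y < n) bruhat_le (tperm x y * u)%g w.

Lemma bruhat_le_fits (i j k : 'I_n) (u v : 'S_n) : uniq [:: i; j; k] ->
  {in [predC [:: i; j; k]], v =1 u} ->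
  reflect (fits (fun p q => \sum_(x < n | x \notin [:: i; j; k]) ((x < p) && (q <= u x)))
                (rk w) i j k (v i) (v j) (v k))
          (bruhat_le v w).
Proof.
move=> us vu.
have E p q : rk v p q = \sum_(x < n | x \notin [:: i; j; k]) ((x < p) && (q <= u x))
  + (((i < p) && (q <= v i)) + ((j < p) && (q <= v j)) + ((k < p) && (q <= v k))).
  rewrite (rk_split _ _ _ us) !big_cons big_nil addn0 addnA addnC; congr (_ + _).
  by apply: eq_bigr => x xs; rewrite vu.
by apply: (iffP (bruhat_leP _ _)) => H p q; have := H p q; rewrite E.
Qed.

Section Cover.

Variables (u : 'S_n) (i j : 'I_n).
Hypotheses (ij : i < j) (uij : u i < u j) (le_w : bruhat_le (tperm i j * u)%g w).

Let v := (tperm i j * u)%g.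

(** The two transpositions commute, so the neighbour of [v] is the neighbour of [u] with the ascent
    at [i], [j] swapped, hence lies above it. *)
Lemma bruhat_le_commuting (x y : 'I_n) : x \notin [:: i; j] -> y \notin [:: i; j] ->
  bruhat_le (tperm x y * v)%g w <= bruhat_le (tperm x y * u)%g w.
Proof.
rewrite !inE !negb_or => /andP[xi xj] /andP[yi yj].
rewrite /v mulgA (conjgC (tperm x y)) tpermJ !tpermD 1?eq_sym //.
rewrite -mulgA; case: (boolP (bruhat_le (tperm i j * _)%g w)) => // H.
rewrite (bruhat_le_tperm ij _ H) // !tperm_actE.
by rewrite ![i == _]eq_sym ![j == _]eq_sym (negPf xi) (negPf yi) (negPf xj) (negPf yj).
Qed.

(** The two edges are taken together: a single edge at [v] may correspond to the other edge at
    [u]. *)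
Lemma bruhat_le_noncommuting (k : 'I_n) : k \notin [:: i; j] ->
  bruhat_le (tperm i k * v)%g w + bruhat_le (tperm j k * v)%g w
  <= bruhat_le (tperm i k * u)%g w + bruhat_le (tperm j k * u)%g w.
Proof.
rewrite !inE negb_or => /andP[ki kj].
have ji : j != i by rewrite -val_eqE /=; lia.
have us : uniq [:: i; j; k] by rewrite /= !inE negb_or ![i == _]eq_sym [j == k]eq_sym ji ki kj.
have [cik ckj] : u k != u i /\ u k != u j by rewrite !(inj_eq perm_inj).
set l := [:: i; j; k] in us.
have agree (x y : 'I_n) (z : 'S_n) : x \in l -> y \in l -> {in [predC l], z =1 u} ->
  {in [predC l], (tperm x y * z)%g =1 u}.
  move=> xl yl zu t tl; rewrite tperm_actE -(zu t tl).
  by do 2![case: eqVneq => [e|_]; first by rewrite inE /= e ?xl ?yl in tl].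
have [il jl kl] : [/\ i \in l, j \in l & k \in l] by rewrite !inE !eqxx !orbT.
have au : {in [predC l], u =1 u} by [].
have av : {in [predC l], v =1 u} by apply: agree.
have E := (tperm_actE, eqxx, negPf ki, negPf kj, negPf ji,
  (eq_sym i k), (eq_sym j k), (eq_sym i j)).
have := bruhat_le_fits us av; have := bruhat_le_fits us (agree i k _ il kl av).
have := bruhat_le_fits us (agree j k _ jl kl av).
have := bruhat_le_fits us (agree i k _ il kl au).
have := bruhat_le_fits us (agree j k _ jl kl au).
rewrite /v !E -/v.
(* With [a], [b], [c] the values of [u] at [i], [j], [k], the facts [r1] to [r5] concern [acb],
   [cba], [bca], [cab] and [bac]. *)
set r := fun p q => _ => r1 r2 r3 r4 r5.
have Fv := elimT r5 le_w.
have A1 := fits_cab ij uij ki kj cik ckj Fv.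
have A2 := fits_bca ij uij ki kj cik ckj Fv.
have A3 := fits_cab_bca ij uij ki kj cik ckj Fv.
case: r4 => [/[dup] h4 /A1 h1|_]; case: r3 => [/[dup] h3 /A2 h2|_] //=.
- by case: (A3 h4 h3) => /r2-> /r1->.
- by case: h1 => [/r2|/r1] ->; rewrite ?leq_addr ?leq_addl.
- by case: h2 => [/r2|/r1] ->; rewrite ?leq_addr ?leq_addl.
Qed.

(** Pairs are grouped by how they meet [i] and [j], so that [u] and [v] compare group by group; the
    last group is unchanged by [tperm i j]. *)
Lemma bdegE (z : 'S_n) : bdeg z =
  \sum_(x < n | x \notin [:: i; j]) (bruhat_le (tperm x i * z)%g w
     + bruhat_le (tperm x j * z)%g w
     + \sum_(y < n | y \notin [:: i; j]) bruhat_le (tperm x y * z)%g w)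
  + (\sum_(y < n | y \notin [:: i; j]) (bruhat_le (tperm i y * z)%g w
     + bruhat_le (tperm j y * z)%g w)
  + (bruhat_le z w + bruhat_le (tperm i j * z)%g w).*2).
Proof.
have us : uniq [:: i; j] by rewrite /= inE andbT -val_eqE /=; lia.
have S (F : 'I_n -> nat) : \sum_(x < n) F x = F i + F j + \sum_(x < n | x \notin [:: i; j]) F x.
  by rewrite (bigID (mem [:: i; j])) /= -big_uniq //= !big_cons big_nil addn0.
rewrite /bdeg S addnC; congr (_ + _); first by apply: eq_bigr => x _; rewrite S.
rewrite !S !tperm1 !mul1g [tperm j i]tpermC big_split /=; lia.
Qed.

Lemma bdeg_tperm : bdeg v <= bdeg u.
Proof.
have uw : bruhat_le u w := bruhat_le_tperm ij uij le_w.
rewrite !bdegE -/v {4}/v tperm_mulK uw le_w; apply: leq_add.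
  apply: leq_sum => x xl; rewrite ![tperm x i]tpermC ![tperm x j]tpermC.
  apply: leq_add; first exact: bruhat_le_noncommuting.
  by apply: leq_sum => y yl; apply: bruhat_le_commuting.
by rewrite leq_add2r; apply: leq_sum => x xl; apply: bruhat_le_noncommuting.
Qed.

Lemma bdeg_tperm_lt_noncommuting (k : 'I_n) : k \notin [:: i; j] ->
  bruhat_le (tperm i k * v)%g w + bruhat_le (tperm j k * v)%g w
  < bruhat_le (tperm i k * u)%g w + bruhat_le (tperm j k * u)%g w ->
  bdeg v < bdeg u.
Proof.
move=> kl lt; have uw : bruhat_le u w := bruhat_le_tperm ij uij le_w.
rewrite !bdegE -/v {4}/v tperm_mulK uw le_w -addnS; apply: leq_add.
  apply: leq_sum => x xl; rewrite ![tperm x i]tpermC ![tperm x j]tpermC.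
  apply: leq_add; first exact: bruhat_le_noncommuting.
  by apply: leq_sum => y yl; apply: bruhat_le_commuting.
rewrite -addSn leq_add2r; apply: (leq_sum_strict (x := k)) => // x xl.
exact: bruhat_le_noncommuting.
Qed.

Lemma bdeg_tperm_lt_commuting (x y : 'I_n) : x \notin [:: i; j] -> y \notin [:: i; j] ->
  ~~ bruhat_le (tperm x y * v)%g w -> bruhat_le (tperm x y * u)%g w ->
  bdeg v < bdeg u.
Proof.
move=> xl yl nv lu; have uw : bruhat_le u w := bruhat_le_tperm ij uij le_w.
rewrite !bdegE -/v {4}/v tperm_mulK uw le_w -addSn; apply: leq_add; last first.
  by rewrite leq_add2r; apply: leq_sum => z zl; apply: bruhat_le_noncommuting.
have le1 z : z \notin [:: i; j] ->
  bruhat_le (tperm z i * v)%g w + bruhat_le (tperm z j * v)%g w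
  <= bruhat_le (tperm z i * u)%g w + bruhat_le (tperm z j * u)%g w.
  by move=> zl; rewrite ![tperm z i]tpermC ![tperm z j]tpermC; apply: bruhat_le_noncommuting.
apply: (leq_sum_strict (x := x)) => //.
  move=> z zl; apply: leq_add; first exact: le1.
  by apply: leq_sum => t tl; apply: bruhat_le_commuting.
rewrite -addnS leq_add ?le1 //; apply: (leq_sum_strict (x := y)) => //.
  by move=> t tl; apply: bruhat_le_commuting.
by rewrite (negPf nv) lu.
Qed.

End Cover.

Lemma tperm_le_self (x y : 'I_n) : x < y ->
  bruhat_le (tperm x y * w)%g w = (w y < w x).
Proof.
move=> xy; case: (ltngtP (w y) (w x)) => [h|h|/val_inj/perm_inj h].
- by apply: bruhat_le_tperm_down => //; apply: bruhat_le_refl.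
(* At this corner of the rectangle in [rk_tperm] the rank exceeds that of [w] by one. *)
- apply/negbTE/negP => /bruhat_leP /(_ y (w y)).
  by rewrite rk_tperm // xy h !leqnn /=; lia.
- by move: xy; rewrite h ltnn.
Qed.

Lemma sum_pairs_sym (F : 'I_n -> 'I_n -> nat) : (forall x y, F x y = F y x) ->
  \sum_(x < n) \sum_(y < n) F x y
  = (\sum_(p : 'I_n * 'I_n | p.1 < p.2) F p.1 p.2).*2 + \sum_(x < n) F x x.
Proof.
move=> Fs; rewrite pair_big /= (bigID (fun p : 'I_n * 'I_n => p.1 < p.2)) /=.
rewrite -addnn -addnA; congr (_ + _).
rewrite (bigID (fun p : 'I_n * 'I_n => p.2 < p.1)) /=; congr (_ + _).
  rewrite (reindex_inj (h := fun p : 'I_n * 'I_n => (p.2, p.1))) /=; last first.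
    by move=> [a b] [c d] /= [-> ->].
  by apply: eq_big => [p|p _]; [lia | rewrite Fs].
rewrite [RHS](reindex_onto (fun p : 'I_n * 'I_n => p.1) (fun x => (x, x))) //=.
apply: eq_big => [[a b]|[a b]] /=.
  by rewrite -!leqNgt -eqn_leq xpair_eqE eqxx /= eq_sym val_eqE.
by rewrite -!leqNgt -eqn_leq => /eqP/val_inj->.
Qed.

Lemma ell_sum (u : 'S_n) : ell u = \sum_(p : 'I_n * 'I_n | p.1 < p.2) (u p.2 < u p.1).
Proof. by rewrite /ell -sum1_card -big_mkcondr; apply: eq_bigl => p; rewrite inE. Qed.

Lemma bdeg_self : bdeg w = (ell w).*2 + n.
Proof.
rewrite /bdeg sum_pairs_sym => [|x y]; last by rewrite tpermC.
congr (_.*2 + _).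
  by rewrite ell_sum; apply: eq_bigr => p /tperm_le_self->.
rewrite -[RHS]card_ord -sum1_card; apply: eq_bigr => x _.
by rewrite tperm1 mul1g bruhat_le_refl.
Qed.

(** Along a chain of steps from [u] up to [w] the degree never grows, and at [w] it is known. *)
Lemma bdeg_ge (u : 'S_n) : bruhat_le u w -> (ell w).*2 + n <= bdeg u.
Proof.
case/connectP => s; elim: s u => [u _ /= <-|v s IH u /= /andP[uv vs] ws].
  by rewrite bdeg_self.
have [i [j [ij uij vE]]] := bruhat_stepP uv.
apply: leq_trans (IH _ vs ws) _; rewrite vE; apply: bdeg_tperm => //.
by rewrite -vE; apply/connectP; exists s.
Qed.

(** Going down never leaves the interval, so [u] has exactly [ell u] downward edges. In total there
    are as many upward edges, each being a downward edge of its upper end. Ordered pairs give the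
    other factor 2. *)
Lemma sum_bdeg : \sum_(u | bruhat_le u w) bdeg u =
  4 * \sum_(u | bruhat_le u w) ell u + n * #|[pred u | bruhat_le u w]|.
Proof.
have E u : bruhat_le u w -> bdeg u = (ell u +
   \sum_(p : 'I_n * 'I_n | p.1 < p.2) ((u p.1 < u p.2) && bruhat_le (tperm p.1 p.2 * u)%g w)).*2 + n.
  move=> uw; rewrite /bdeg sum_pairs_sym => [|x y]; last by rewrite tpermC.
  congr (_.*2 + _).
    rewrite ell_sum -big_split /=; apply: eq_bigr => -[x y] /= xy.
    case: (ltngtP (u y) (u x)) => [h|h|/val_inj/perm_inj h] //=.
    - by rewrite bruhat_le_tperm_down.
    - by move: xy; rewrite h ltnn.
  rewrite -[RHS]card_ord -sum1_card; apply: eq_bigr => x _.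
  by rewrite tperm1 mul1g uw.
rewrite (eq_bigr _ E) big_split /= sum_nat_const mulnC; congr (_ + _).
rewrite -(big_morph _ doubleD double0) big_split /=.
suff -> : \sum_(u | bruhat_le u w) \sum_(p : 'I_n * 'I_n | p.1 < p.2)
    ((u p.1 < u p.2) && bruhat_le (tperm p.1 p.2 * u)%g w) = \sum_(u | bruhat_le u w) ell u.
  by rewrite addnn -!mul2n mulnA.
rewrite exchange_big /= [RHS](eq_bigr _ (fun u _ => ell_sum u)).
rewrite [RHS]exchange_big /=; apply: eq_bigr => -[x y] /= xy.
rewrite [RHS](reindex_inj (mulgI (tperm x y))) /= -!big_mkcondr.
apply: eq_bigl => u; rewrite !tperm_actE !eqxx.
have /negPf-> : y != x by rewrite -val_eqE /=; lia.
case: (ltnP (u x) (u y)) => h; rewrite ?andbF // !andbT.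
case: (boolP (bruhat_le (tperm x y * u)%g w)) => [/(bruhat_le_tperm xy h)->|_]; rewrite ?andbF //.
Qed.

End BruhatDegree.

(** * Degree drops caused by the two patterns *)

Definition has3412 (n : nat) (w : 'S_n) : Prop := exists a b c d : 'I_n,
  [/\ a < b, b < c & c < d] /\ [/\ w c < w d, w d < w a & w a < w b].

Definition has4231 (n : nat) (w : 'S_n) : Prop := exists a b c d : 'I_n,
  [/\ a < b, b < c & c < d] /\ [/\ w d < w b, w b < w c & w c < w a].

Lemma word4E (s : seq nat) (ps : perm_eq s [:: 1; 2; 3; 4]) (i : 'I_4) :
  perm (word4_inj ps) i = (nth 0 s i).-1 :> nat.
Proof.
rewrite permE /word4 inordK //.
have : nth 0 s i \in s by rewrite mem_nth ?(perm_size ps).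
by rewrite (perm_mem ps) !inE => /or4P[] /eqP->.
Qed.

Lemma ord4P (P : 'I_4 -> Prop) : P (inord 0) -> P (inord 1) -> P (inord 2) -> P (inord 3) ->
  forall i, P i.
Proof.
by move=> P0 P1 P2 P3 i; rewrite -(inord_val i); case: i => [[|[|[|[|]]]]].
Qed.

Lemma contains3412 n (w : 'S_n) : contains_pattern w p3412 <-> has3412 w.
Proof.
split=> [[f [fi fo]]|[a [b [c [d [[ab bc cd] [h1 h2 h3]]]]]]].
  exists (f (inord 0)), (f (inord 1)), (f (inord 2)), (f (inord 3)).
  by rewrite !fo !word4E !inordK //; split; split=> //; apply: fi; rewrite !inordK.
exists (fun i : 'I_4 => nth a [:: a; b; c; d] i); split.
  by elim/ord4P; elim/ord4P; rewrite !inordK //= => _; lia.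
by elim/ord4P; elim/ord4P; rewrite !word4E !inordK //=; lia.
Qed.

Lemma contains4231 n (w : 'S_n) : contains_pattern w p4231 <-> has4231 w.
Proof.
split=> [[f [fi fo]]|[a [b [c [d [[ab bc cd] [h1 h2 h3]]]]]]].
  exists (f (inord 0)), (f (inord 1)), (f (inord 2)), (f (inord 3)).
  by rewrite !fo !word4E !inordK //; split; split=> //; apply: fi; rewrite !inordK.
exists (fun i : 'I_4 => nth a [:: a; b; c; d] i); split.
  by elim/ord4P; elim/ord4P; rewrite !inordK //= => _; lia.
by elim/ord4P; elim/ord4P; rewrite !word4E !inordK //=; lia.
Qed.

Lemma bruhat_le_agree n (s : seq 'I_n) (v w : 'S_n) : uniq s -> {in [predC s], v =1 w} ->
  reflect (forall p q, \sum_(a <- s) ((a < p) && (q <= v a))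
                    <= \sum_(a <- s) ((a < p) && (q <= w a)))
          (bruhat_le v w).
Proof.
move=> us vw; apply: (iffP (bruhat_leP _ _)) => H p q; have := H p q.
  by move=> h; rewrite -(leq_add2l (rk v p q)) (rk_agree _ _ us vw) leq_add2r.
by move=> h; rewrite -(leq_add2r (\sum_(a <- s) ((a < p) && (q <= v a))))
  -(rk_agree _ _ us vw) leq_add2l.
Qed.

Lemma agree_tperm n (s : seq 'I_n) (x y : 'I_n) (v w : 'S_n) : x \in s -> y \in s ->
  {in [predC s], v =1 w} -> {in [predC s], (tperm x y * v)%g =1 w}.
Proof.
move=> xs ys vw t ts; rewrite tperm_actE -(vw t ts).
by do 2![case: eqVneq => [e|_]; first by rewrite inE /= e ?xs ?ys in ts].
Qed.

Section Cells.

Variables a b c d : nat.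

(** The rank contribution of four positions; the final [0] matches the unfolding of a big sum over a
    list. In the lemma names below, the digits 1 to 4 stand for [x < y < z < t]. *)
Definition cells (p q x y z t : nat) : nat :=
  ((a < p) && (q <= x)) + (((b < p) && (q <= y))
    + (((c < p) && (q <= z)) + (((d < p) && (q <= t)) + 0))).

Variables x y z t : nat.
Hypotheses (ab : a < b) (bc : b < c) (cd : c < d) (xy : x < y) (yz : y < z) (zt : z < t).

Lemma cells_2413_4231 p q : cells p q y t x z <= cells p q t y z x.
Proof. by rewrite /cells; lia. Qed.

Lemma cells_3142_4231 p q : cells p q z x t y <= cells p q t y z x.
Proof. by rewrite /cells; lia. Qed.

Lemma cells_3412_4231 : cells b.+1 z t y z x < cells b.+1 z z t x y.
Proof. by rewrite /cells; lia. Qed.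

Lemma cells_3124_3412 p q : cells p q z x y t <= cells p q z t x y.
Proof. by rewrite /cells; lia. Qed.

Lemma cells_1423_3412 p q : cells p q x t y z <= cells p q z t x y.
Proof. by rewrite /cells; lia. Qed.

Lemma cells_4123_3412 : cells a.+1 t z t x y < cells a.+1 t t x y z.
Proof. by rewrite /cells; lia. Qed.

Lemma cells_3421_3412 : cells c.+1 y z t x y < cells c.+1 y z t y x.
Proof. by rewrite /cells; lia. Qed.

End Cells.

Section FourPositions.

Variables (n : nat) (w : 'S_n) (a b c d : 'I_n).
Hypotheses (ab : a < b) (bc : b < c) (cd : c < d).

Let s := [:: a; b; c; d].

Let neqs : [/\ (a == b) = false, (a == c) = false, (a == d) = false &
             [/\ (b == c) = false, (b == d) = false & (c == d) = false]].
Proof. by split; [..|split]; apply/negbTE; rewrite -val_eqE /=; lia. Qed.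

Let us : uniq s.
Proof. by case: neqs => h1 h2 h3 [h4 h5 h6]; rewrite /= !inE h1 h2 h3 h4 h5 h6. Qed.

(* With [w] of pattern 4231 on these positions, the drop in degree occurs when
   going up from 2143 to 2413. *)
Lemma bdeg_gt_4231 : w d < w b -> w b < w c -> w c < w a ->
  exists2 u, bruhat_le u w & (ell w).*2 + n < bdeg w u.
Proof.
move=> db bc' ca; have [h1 h2 h3 [h4 h5 h6]] := neqs.
have [as' bs cs ds] : [/\ a \in s, b \in s, c \in s & d \in s] by rewrite !inE !eqxx !orbT.
have E := (tperm_actE, eqxx, h1, h2, h3, h4, h5, h6,
  ((eq_sym b a, eq_sym c a, eq_sym d a), (eq_sym c b, eq_sym d b, eq_sym d c))).
pose v := (tperm c d * (tperm a b * w))%g; pose u := (tperm b c * v)%g.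
have av : {in [predC s], v =1 w} by do 2!apply: agree_tperm => //.
have au : {in [predC s], u =1 w} by apply: agree_tperm.
have vE : v = (tperm b c * u)%g by rewrite tperm_mulK.
have vw : bruhat_le v w.
  apply/(bruhat_le_agree us av) => p q; rewrite !big_cons !big_nil /v !E.
  exact: cells_2413_4231.
have ubc : u b < u c by rewrite /u /v !E (ltn_trans db) // (ltn_trans bc').
have uw : bruhat_le u w by rewrite vE in vw; apply: bruhat_le_tperm vw.
exists u => //; apply: leq_ltn_trans (bdeg_ge vw) _; rewrite {1}vE.
(* The edge lost is the transposition of [a] and [d]: it turns 2143 into 3142, below 4231, but 2413
   into 3412, which is not. *)
apply: (@bdeg_tperm_lt_commuting _ _ _ _ _ bc ubc _ a d); rewrite -?vE //.
- by rewrite !inE h1 h2.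
- by rewrite !inE !E.
- apply/negP => /(bruhat_le_agree us (agree_tperm as' ds av)) /(_ b.+1 (w c)).
  by rewrite !big_cons !big_nil /v !E leqNgt cells_3412_4231.
- apply/(bruhat_le_agree us (agree_tperm as' ds au)) => p q.
  by rewrite !big_cons !big_nil /u /v !E; apply: cells_3142_4231.
Qed.

(* With [w] of pattern 3412 on these positions, the drop in degree occurs when
   going up from 1324 to 3124. *)
Lemma bdeg_gt_3412 : w c < w d -> w d < w a -> w a < w b ->
  exists2 u, bruhat_le u w & (ell w).*2 + n < bdeg w u.
Proof.
move=> cd' da ab'; have [h1 h2 h3 [h4 h5 h6]] := neqs.
have [as' bs cs ds] : [/\ a \in s, b \in s, c \in s & d \in s] by rewrite !inE !eqxx !orbT.
have E := (tperm_actE, eqxx, h1, h2, h3, h4, h5, h6,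
  ((eq_sym b a, eq_sym c a, eq_sym d a), (eq_sym c b, eq_sym d b, eq_sym d c))).
pose v := (tperm c d * (tperm b c * w))%g; pose u := (tperm a b * v)%g.
have av : {in [predC s], v =1 w} by do 2!apply: agree_tperm => //.
have au : {in [predC s], u =1 w} by apply: agree_tperm.
have vE : v = (tperm a b * u)%g by rewrite tperm_mulK.
have vw : bruhat_le v w.
  apply/(bruhat_le_agree us av) => p q; rewrite !big_cons !big_nil /v !E.
  exact: cells_3124_3412.
have uab : u a < u b by rewrite /u /v !E (ltn_trans cd').
have uw : bruhat_le u w by rewrite vE in vw; apply: bruhat_le_tperm vw.
exists u => //; apply: leq_ltn_trans (bdeg_ge vw) _; rewrite {1}vE.
(* Look at the edges from [a] and [b] to [d]: from 3124 they lead to 4123 and 3421, neither below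
   3412, whereas 1324 keeps its neighbour 1423. *)
apply: (@bdeg_tperm_lt_noncommuting _ _ _ _ _ ab uab _ d); rewrite -?vE //.
  by rewrite !inE !E.
have /negPf-> : ~~ bruhat_le (tperm a d * v)%g w.
  apply/negP => /(bruhat_le_agree us (agree_tperm as' ds av)) /(_ a.+1 (w b)).
  by rewrite !big_cons !big_nil /v !E leqNgt cells_4123_3412.
have /negPf-> : ~~ bruhat_le (tperm b d * v)%g w.
  apply/negP => /(bruhat_le_agree us (agree_tperm bs ds av)) /(_ c.+1 (w d)).
  by rewrite !big_cons !big_nil /v !E leqNgt cells_3421_3412.
suff -> : bruhat_le (tperm b d * u)%g w by rewrite addn1.
apply/(bruhat_le_agree us (agree_tperm bs ds au)) => p q.
by rewrite !big_cons !big_nil /u /v !E; apply: cells_1423_3412.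
Qed.

End FourPositions.

(** One degree exceeds the lower bound of [bdeg_ge], so the sum of all degrees does too; by
    [sum_bdeg] this bounds the total length. *)
Lemma sum_ell_gt n (w : 'S_n) : has3412 w \/ has4231 w ->
  ell w * #|[pred u | bruhat_le u w]| < 2 * \sum_(u | bruhat_le u w) ell u.
Proof.
move=> H.
have [u uw lt] : exists2 u, bruhat_le u w & (ell w).*2 + n < bdeg w u.
  case: H => -[a [b [c [d [[ab bc cd] [h1 h2 h3]]]]]].
    exact: bdeg_gt_3412 h1 h2 h3.
  exact: bdeg_gt_4231 h1 h2 h3.
have : \sum_(v | bruhat_le v w) ((ell w).*2 + n) < \sum_(v | bruhat_le v w) bdeg w v.
  by apply: (leq_sum_strict (x := u)) => // v; apply: bdeg_ge.
rewrite sum_bdeg sum_nat_const.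
move: (\sum_(v | _) _) #|_| => S N; nia.
Qed.

(** * Reversal and inversion *)

Lemma orientationP n (G : rel 'I_n) (O : {set 'I_n * 'I_n}) :
  reflect ((forall i j, G i j -> has_arc O i j = ~~ has_arc O j i) /\
           (forall i j, has_arc O i j -> G i j))
          (is_orientation G O).
Proof.
apply: (iffP forallP) => [H|[H1 H2] i].
  split=> i j; have /forallP/(_ j) := H i; case: (G i j) => //.
  - by case: (has_arc O i j); case: (has_arc O j i).
  - by move=> /negPf->.
apply/forallP => j; case: (boolP (G i j)) => [/H1->|nG].
  by case: (has_arc O j i).
by apply: contra nG; apply: H2.
Qed.

Lemma acyclic_height n (O : {set 'I_n * 'I_n}) :
  acyclic O <-> exists h : 'I_n -> nat, forall i j, has_arc O i j -> h i < h j.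
Proof.
split=> [acO|[h hO]].
  (* The height of [i] is the number of vertices with a directed path to [i]. *)
  exists (fun i => #|[set x | connect (has_arc O) x i]|) => i j ij.
  apply: proper_card; apply/properP; split.
    apply/subsetP => x; rewrite !inE => xi.
    exact: connect_trans xi (connect1 ij).
  exists j; rewrite inE ?connect0 //.
  by have /forallP/(_ i)/forallP/(_ j)/implyP/(_ ij) := acO.
apply/forallP => i; apply/forallP => j; apply/implyP => ij.
apply/negP => /connectP[p].
have le_path : forall x, path (has_arc O) x p -> h x <= h (last x p).
  elim: p => //= y p IH x /andP[xy yp].
  by apply: leq_trans (IH _ yp); apply: ltnW; apply: hO.
by move=> /le_path + e; rewrite -e leqNgt hO.
Qed.

(** Relabels the vertices by [f] and reverses every arc. With [f = 1] this is plain reversal; with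
    [f = w] it carries orientations of [G_w] to those of the inverse's graph and preserves descents,
    since [w] reverses the order of each edge. *)
Definition flip n (f : 'S_n) (O : {set 'I_n * 'I_n}) : {set 'I_n * 'I_n} :=
  [set a | ((f^-1)%g a.2, (f^-1)%g a.1) \in O].

Lemma flipE n (f : 'S_n) O i j : has_arc (flip f O) (f j) (f i) = has_arc O i j.
Proof. by rewrite /has_arc inE /= !permK. Qed.

Lemma flipK n (f : 'S_n) : cancel (flip f) (flip f^-1).
Proof. by move=> O; apply/setP => -[i j]; rewrite !inE /= invgK !permK. Qed.

Lemma flip_orientation n (f : 'S_n) (G G' : rel 'I_n) O :
  (forall i j, G' (f j) (f i) = G i j) -> is_orientation G O -> is_orientation G' (flip f O).
Proof.
move=> GG /orientationP[H1 H2]; apply/orientationP; split=> i j;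
  rewrite -(permKV f i) -(permKV f j) GG !flipE; first exact: H1.
exact: H2.
Qed.

Lemma flip_acyclic n (f : 'S_n) (O : {set 'I_n * 'I_n}) : acyclic O -> acyclic (flip f O).
Proof.
case/acyclic_height => h hO; apply/acyclic_height.
exists (fun i => \max_x h x - h ((f^-1)%g i)) => i j.
rewrite -{1}(permKV f i) -{1}(permKV f j) flipE => /hO lt.
by rewrite ltn_sub2l // (leq_trans lt) // leq_bigmax.
Qed.

Lemma inversion_graph_inv n (w : 'S_n) i j :
  inversion_graph w^-1%g (w j) (w i) = inversion_graph w i j.
Proof. by rewrite /inversion_graph !permK; lia. Qed.

Lemma des_sum n (O : {set 'I_n * 'I_n}) :
  des O = \sum_(a : 'I_n * 'I_n) (has_arc O a.1 a.2 && (a.2 < a.1)).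
Proof. by rewrite -big_mkcond /des -sum1_card; apply: eq_bigl => -[i j]; rewrite inE. Qed.

Lemma des_flip n (f : 'S_n) (O : {set 'I_n * 'I_n}) :
  des (flip f O) = \sum_(a : 'I_n * 'I_n) (has_arc O a.1 a.2 && (f a.1 < f a.2)).
Proof.
rewrite des_sum (reindex_inj (h := fun a : 'I_n * 'I_n => (f a.2, f a.1))) /=.
  by apply: eq_bigr => a _; rewrite flipE.
by move=> [a b] [c d] /= [/perm_inj-> /perm_inj->].
Qed.

Lemma flip_bij_sum n (f : 'S_n) (G G' : rel 'I_n) (F : {set 'I_n * 'I_n} -> {poly int}) :
  (forall i j, G' (f j) (f i) = G i j) ->
  (\sum_(O : {set 'I_n * 'I_n} | is_orientation G' O && acyclic O) F O =
   \sum_(O : {set 'I_n * 'I_n} | is_orientation G O && acyclic O) F (flip f O))%R.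
Proof.
move=> GG; rewrite (reindex_inj (can_inj (flipK f))); apply: eq_bigl => O.
apply/andP/andP => -[H1 H2]; last by rewrite (flip_orientation GG) ?flip_acyclic.
rewrite -(flipK f O) flip_acyclic // (flip_orientation _ H1) // => i j.
by rewrite -GG !permKV.
Qed.

Lemma inversion_poly_inv n (w : 'S_n) : inversion_poly w^-1 = inversion_poly w.
Proof.
rewrite /inversion_poly /acyclic_orientation_poly.
rewrite (flip_bij_sum _ (inversion_graph_inv w)).
apply: eq_bigr => O /andP[/orientationP[_ H] _]; congr ('X^_)%R.
rewrite des_flip des_sum; apply: eq_bigr => -[i j] _ /=.
case: (boolP (has_arc O i j)) => //= /H; rewrite /inversion_graph; lia.
Qed.

(** Each edge is a descent in exactly one of [O] and its reversal. *)
Lemma des_reverse n (w : 'S_n) (O : {set 'I_n * 'I_n}) :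
  is_orientation (inversion_graph w) O -> des O + des (flip 1 O) = ell w.
Proof.
case/orientationP => H1 H2; rewrite des_flip des_sum ell_sum.
rewrite (reindex_inj (h := fun a : 'I_n * 'I_n => (a.2, a.1))) /=; last first.
  by move=> [a b] [c d] /= [-> ->].
rewrite -big_split [RHS]big_mkcond /=; apply: eq_bigr => -[i j] _ /=; rewrite !perm1.
case: (ltnP i j) => ij; last by rewrite !andbF.
rewrite !andbT; case: (boolP (inversion_graph w i j)) => G.
  rewrite (H1 _ _ G); case: (has_arc O j i) => /=; move: G; rewrite /inversion_graph; lia.
have /negPf-> : ~~ has_arc O i j by apply: contra G; apply: H2.
have /negPf-> : ~~ has_arc O j i by apply: contra G => /H2; rewrite inversion_graph_sym.
by move: G; rewrite /inversion_graph; lia.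
Qed.

(** * Counts and totals of a statistic, read off its polynomial at 1 *)

Section PolyStat.

Local Open Scope ring_scope.

Variables (I : finType) (P : pred I) (f : I -> nat).

Lemma stat_poly_eval1 : (\sum_(x | P x) 'X^(f x) : {poly int}).[1] = #|P|%:R.
Proof.
rewrite horner_sum -GRing.sumr_const; apply: eq_bigr => x _.
by rewrite hornerXn GRing.expr1n.
Qed.

Lemma stat_poly_deriv_eval1 :
  ((\sum_(x | P x) 'X^(f x) : {poly int})^`()).[1] = (\sum_(x | P x) f x)%N%:R.
Proof.
rewrite GRing.raddf_sum horner_sum GRing.natr_sum; apply: eq_bigr => x _.
by rewrite /= derivXn hornerMn hornerXn GRing.expr1n.
Qed.

End PolyStat.

(** Pairing each acyclic orientation with its reversal makes the average number of descents
    [ell w / 2]. *)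
Lemma sum_des_reverse n (w : 'S_n) :
  let P (O : {set 'I_n * 'I_n}) := is_orientation (inversion_graph w) O && acyclic O in
  2 * \sum_(O | P O) des O = ell w * #|P|.
Proof.
move=> P; rewrite mul2n -addnn mulnC -sum_nat_const.
have K : cancel (flip (1 : 'S_n)) (flip 1%g) by move=> O; rewrite -{2}(flipK 1 O) invg1.
rewrite {2}(reindex_inj (can_inj K)) /=.
have PE O : P (flip 1 O) = P O.
  have GG i j : inversion_graph w ((1 : 'S_n)%g j) ((1 : 'S_n)%g i) = inversion_graph w i j.
    by rewrite !perm1 inversion_graph_sym.
  apply/andP/andP => -[H1 H2]; last by rewrite (flip_orientation GG) ?flip_acyclic.
  split; rewrite -(K O); [exact: (flip_orientation GG) | exact: flip_acyclic].
rewrite (eq_bigl P) // -big_split /=; apply: eq_bigr => O /andP[O1 _].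
exact: des_reverse.
Qed.

(** Equal polynomials have equal values and derivatives at 1, hence the same average exponent; by
    [sum_ell_gt] the average length exceeds [ell w / 2]. *)
Lemma poincare_neq_inversion_poly n (w : 'S_n) :
  has3412 w \/ has4231 w -> poincare w <> inversion_poly w.
Proof.
move=> /sum_ell_gt lt E.
have := congr1 (fun p => p.[1]%R) E; rewrite !stat_poly_eval1 => /eqP.
rewrite Num.Theory.eqr_nat => /eqP E0.
have := congr1 (fun p => (p^`()).[1]%R) E; rewrite !stat_poly_deriv_eval1 => /eqP.
rewrite Num.Theory.eqr_nat => /eqP E1.
by move: lt; rewrite E1 E0 sum_des_reverse ltnn.
Qed.

Lemma ell_inv n (u : 'S_n) : ell u^-1 = ell u.
Proof.
rewrite !ell_sum big_mkcond [RHS]big_mkcond /=.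
rewrite (reindex_inj (h := fun a : 'I_n * 'I_n => (u a.2, u a.1))) /=.
  by apply: eq_bigr => -[i j] _ /=; rewrite !permK; case: (ltnP i j); case: (ltnP (u j) (u i)).
by move=> [a b] [c d] /= [/perm_inj-> /perm_inj->].
Qed.

(** Both sides count the [a] with [u a < p] or [a < q], split in two ways. *)
Lemma rk_inv n (u : 'S_n) p q :
  rk u^-1%g p q + \sum_(a < n) (a < q) = \sum_(a < n) (a < p) + rk u q p.
Proof.
rewrite /rk (reindex_inj (@perm_inj _ u)) /= [X in _ = X + _](reindex_inj (@perm_inj _ u)) /=.
by rewrite -!big_split /=; apply: eq_bigr => a _; rewrite permK; lia.
Qed.

Lemma bruhat_le_inv n (u w : 'S_n) : bruhat_le u^-1%g w^-1%g = bruhat_le u w.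
Proof.
have H (x y : 'S_n) : bruhat_le x y -> bruhat_le x^-1%g y^-1%g.
  move/bruhat_leP => xy; apply/bruhat_leP => p q.
  have := xy q p; have := rk_inv x p q; have := rk_inv y p q.
  move: (\sum_(a < n) (a < p)) (\sum_(a < n) (a < q)) (rk _ p q) (rk _ p q) (rk _ q p) (rk _ q p).
  by lia.
by apply/idP/idP => /H //; rewrite !invgK.
Qed.

Lemma poincare_inv n (w : 'S_n) : poincare w^-1 = poincare w.
Proof.
rewrite /poincare (reindex_inj invg_inj) /=.
by apply: eq_big => [u|u _]; rewrite ?bruhat_le_inv ?ell_inv.
Qed.

Lemma has3412_inv n (w : 'S_n) : has3412 w^-1%g -> has3412 w.
Proof.
move=> [a [b [c [d [[ab bc cd] [h1 h2 h3]]]]]].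
by exists (w^-1 c)%g, (w^-1 d)%g, (w^-1 a)%g, (w^-1 b)%g; rewrite !permKV.
Qed.

Lemma has4231_inv n (w : 'S_n) : has4231 w^-1%g -> has4231 w.
Proof.
move=> [a [b [c [d [[ab bc cd] [h1 h2 h3]]]]]].
by exists (w^-1 d)%g, (w^-1 b)%g, (w^-1 c)%g, (w^-1 a)%g; rewrite !permKV.
Qed.

(** * Deletion of the maximal value *)

Lemma rkS n (f : 'I_n -> 'I_n) (a : 'I_n) q : rk f a.+1 q = rk f a q + (q <= f a).
Proof.
rewrite /rk (bigD1 a) //= [X in _ = X + _](bigD1 a) //= ltnSn ltnn /= addnC; congr (_ + _).
by apply: eq_bigr => x; rewrite -val_eqE /= => xa; rewrite ltnS leq_eqVlt (negPf xa).
Qed.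

Lemma rk_leS n (f : 'I_n -> 'I_n) p q : rk f p.+1 q <= (rk f p q).+1.
Proof.
have [pn|np] := ltnP p n; first by rewrite (rkS f (Ordinal pn)) /= -addn1 leq_add2l leq_b1.
rewrite ltnW // ltnS; apply: leq_sum => a _.
by have := ltn_ord a; case: (ltnP a p); lia.
Qed.

Lemma rk_le_all n (f : 'I_n -> 'I_n) p q : rk f p q <= \sum_(a < n) (q <= f a).
Proof. by apply: leq_sum => a _; case: (a < p). Qed.

Lemma rk_big n (f : 'I_n -> 'I_n) p q : n <= q -> rk f p q = 0.
Proof.
move=> nq; apply: big1 => a _; rewrite (leqNgt q) (leq_trans (ltn_ord _) nq).
by rewrite andbF.
Qed.

Lemma ltn_lift n (k : 'I_n.+1) (a : 'I_n) p : (lift k a < p) = (a < p - (k < p)).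
Proof. by rewrite /= /bump; case: (leqP k a); case: (ltnP k p); lia. Qed.

Lemma ltn_lift2 n (k : 'I_n.+1) (a b : 'I_n) : (lift k a < lift k b) = (a < b).
Proof. by rewrite /= /bump; case: (leqP k a); case: (leqP k b); lia. Qed.

Lemma lift_gt n (k : 'I_n.+1) (a : 'I_n) : (k < lift k a) = (k <= a).
Proof. by rewrite /= /bump; case: (leqP k a); lia. Qed.

Lemma lift_lt n (k : 'I_n.+1) (a : 'I_n) : (lift k a < k) = (a < k).
Proof. by rewrite ltn_lift ltnn subn0. Qed.

Section InsertMax.

Variable n : nat.

Definition insert_max (k : 'I_n.+1) (u : 'S_n) : 'S_n.+1 := lift_perm k ord_max u.

Lemma insert_max_id k u : insert_max k u k = ord_max.
Proof. exact: lift_perm_id. Qed.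

Lemma insert_max_lift k u a : insert_max k u (lift k a) = u a :> nat.
Proof. by rewrite /insert_max lift_perm_lift lift_max. Qed.

Lemma insert_max_bij : bijective (fun x : 'I_n.+1 * 'S_n => insert_max x.1 x.2).
Proof.
apply: inj_card_bij => [[k u] [l v] /= E|]; last first.
  by rewrite card_prod card_ord !card_Sn factS.
have kl : k = l by apply: (@perm_inj _ (insert_max k u)); rewrite {2}E !insert_max_id.
rewrite kl in E *; congr pair; apply/permP => a; apply: val_inj.
by rewrite /= -(insert_max_lift l) E insert_max_lift.
Qed.

Lemma rk_insert_max k u p q :
  rk (insert_max k u) p q = rk u (p - (k < p)) q + ((k < p) && (q <= n)).
Proof.
rewrite /rk (bigD1_ord k) //= insert_max_id addnC; congr (_ + _).
by apply: eq_bigr => a _; rewrite insert_max_lift ltn_lift.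
Qed.

Lemma ell_double_sum m (u : 'S_m) :
  ell u = \sum_(x < m) \sum_(y < m) ((x < y) && (u y < u x)).
Proof.
rewrite ell_sum pair_big big_mkcond /=.
by apply: eq_bigr => -[x y] _ /=; case: ltnP.
Qed.

Lemma sum_geq (k : 'I_n.+1) : \sum_(b < n) (k <= b) = n - k.
Proof.
rewrite -big_mkcond /= -(big_geq_mkord k n xpredT (fun=> 1)).
by rewrite sum_nat_const_nat muln1.
Qed.

Lemma ell_insert_max k u : ell (insert_max k u) = ell u + (n - k).
Proof.
rewrite !ell_double_sum (bigD1_ord k) //= addnC -sum_geq; congr (_ + _).
  apply: eq_bigr => x _; rewrite (bigD1_ord k) //= insert_max_id !insert_max_lift.
  rewrite [n < _]ltnNge (ltnW (ltn_ord _)) andbF add0n; apply: eq_bigr => y _.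
  by rewrite insert_max_lift ltn_lift2.
rewrite (bigD1_ord k) //= ltnn add0n; apply: eq_bigr => y _.
by rewrite lift_gt insert_max_lift insert_max_id ltn_ord andbT.
Qed.

(** * Deletion when the values decrease after the maximum *)

Section Decreasing.

Variables (d : 'I_n.+1) (w : 'S_n).
Hypothesis w_dec : forall a b : 'I_n, d <= a -> a < b -> w b < w a.

(** At [q = n] only the inserted maximum counts, which forces [d <= k]. For smaller [q] it
    contributes equally on both sides unless [d < p <= k]; there the right side has a spare unit,
    but [w] is read one position less far. *)
Lemma bruhat_le_insert_max (k : 'I_n.+1) (u : 'S_n) :
  bruhat_le (insert_max k u) (insert_max d w) = (d <= k) && bruhat_le u w.
Proof.
apply/bruhat_leP/andP => [H|[dk /bruhat_leP uw] p q].
  have dk : d <= k.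
    have := H k.+1 n; rewrite !rk_insert_max !rk_big // ltnSn leqnn /=.
    by rewrite ltnS; case: (d <= k).
  split=> //; apply/bruhat_leP => p q.
  have [nq|qn] := leqP n q; first by rewrite !rk_big.
  have [pd|dp] := leqP p d.
    have := H p q; rewrite !rk_insert_max !ltnNge pd (leq_trans pd dk) /=.
    by rewrite !addn0 !subn0.
  have [kp|pk] := leqP k p.
    have := H p.+1 q; rewrite !rk_insert_max !ltnS kp (leq_trans dk kp) (ltnW qn) /=.
    by rewrite !subn1 /= leq_add2r.
  have pn : p.-1 < n by have := ltn_ord k; lia.
  have pE : p = (Ordinal pn).+1 by move=> /=; lia.
  have := H p q; rewrite !rk_insert_max dp ltnNge (ltnW pk) (ltnW qn) /= addn0 subn0 subn1.
  rewrite pE (rkS w) /=; set a := Ordinal pn.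
  (* If [w a < q], the decreasing tail has no value at least [q] from [a] on, so the rank of [w]
     already counts all values at least [q], which bounds any rank of [u]. *)
  case: (leqP q (w a)) => // wq _; rewrite addn0.
  suff -> : rk w a q = \sum_(x < n) (q <= x).
    by rewrite [X in _ <= X](reindex_inj (@perm_inj _ u)); apply: rk_le_all.
  rewrite (reindex_inj (@perm_inj _ w)); apply: eq_bigr => x _.
  case: (ltngtP x a) => //= xa; last first.
    by rewrite (_ : x = a) ?(leqNgt q) ?wq //; apply: val_inj.
  have da : d <= a by rewrite /=; lia.
  by rewrite leqNgt (ltn_trans (w_dec da xa)).
rewrite !rk_insert_max.
have [nq|qn] := leqP n q.
  rewrite !rk_big // !add0n; case: (ltnP k p) => //= kp.
  by rewrite (leq_ltn_trans dk kp).
rewrite (ltnW qn) !andbT.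
have [kp|pk] := ltnP k p; first by rewrite (leq_ltn_trans dk kp) leq_add2r.
rewrite addn0 subn0; have [dp|pd] := ltnP d p; last by rewrite addn0 subn0.
(* The extra position read in [u] adds at most one, which the inserted maximum makes up for. *)
rewrite subn1 addn1; apply: leq_trans (_ : (rk u p.-1 q).+1 <= _); last by rewrite ltnS.
by rewrite -{1}(prednK (leq_ltn_trans (leq0n _) dp)) rk_leS.
Qed.

Lemma poincare_insert_max :
  poincare (insert_max d w) = ((\sum_(k < n.+1 | (d <= k)%N) 'X^(n - k)) * poincare w)%R.
Proof.
rewrite /poincare (reindex _ (onW_bij _ insert_max_bij)) big_distrl /=.
under [RHS]eq_bigr do rewrite big_distrr /=.
rewrite pair_big /=; apply: eq_big => [[k u]|[k u] _] /=.
  by rewrite bruhat_le_insert_max.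
by rewrite ell_insert_max GRing.exprD GRing.mulrC.
Qed.

(** * Acyclic orientations and the insertion of a vertex *)

Local Notation G := (inversion_graph (insert_max d w)).
Local Notation G' := (inversion_graph w).

Implicit Types (a b x y z : 'I_n).
Implicit Types (O : {set 'I_n * 'I_n}) (Q : {set 'I_n.+1 * 'I_n.+1}).

Lemma edge_lift a b : G (lift d a) (lift d b) = G' a b.
Proof. by rewrite /inversion_graph !ltn_lift2 !insert_max_lift. Qed.

Lemma edge_max b : G d (lift d b) = (d <= b).
Proof.
rewrite /inversion_graph insert_max_id insert_max_lift lift_gt lift_lt /= ltn_ord.
by rewrite [n < _]ltnNge (ltnW (ltn_ord _)) andbT andbF orbF.
Qed.

Lemma edge_max_sym b : G (lift d b) d = (d <= b).
Proof. by rewrite inversion_graph_sym edge_max. Qed.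

(** The neighbours of [d] thus form a clique, which an acyclic orientation orders totally. *)
Lemma edge_clique a b : d <= a -> d <= b -> a != b -> G' a b.
Proof.
move=> da db; rewrite -val_eqE /inversion_graph /=.
by case: (ltngtP a b) => //= [ab|ba] _; rewrite w_dec.
Qed.

Definition clique_preds O x : {set 'I_n} := [set y : 'I_n | (d <= y) && has_arc O y x].

(** For [x] in the clique and [O] an acyclic orientation, this is the place of [x] in the induced
    total order, counted from 0. *)
Definition clique_rank O x : nat := #|clique_preds O x|.

(* Inserts [d] into the total order induced by [O] on the clique of its
   neighbours, after the first [n - k] of them. *)
Definition extend (k : 'I_n.+1) O : {set 'I_n.+1 * 'I_n.+1} :=
  [set a | match unlift d a.1, unlift d a.2 with
           | Some x, Some y => has_arc O x y
           | Some x, None => (d <= x) && (clique_rank O x < n - k)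
           | None, Some y => (d <= y) && (n - k <= clique_rank O y)
           | None, None => false
           end].

Definition restrict Q : {set 'I_n * 'I_n} := [set a | has_arc Q (lift d a.1) (lift d a.2)].

Definition max_preds Q : {set 'I_n} := [set x | has_arc Q (lift d x) d].

(** Inverse of [extend], which puts [n - k] neighbours before [d]. The argument of [inord] is at
    most [n], so its default value never occurs. *)
Definition split_orientation Q : 'I_n.+1 * {set 'I_n * 'I_n} :=
  (inord (n - #|max_preds Q|), restrict Q).

Lemma extend_lift k O x y : has_arc (extend k O) (lift d x) (lift d y) = has_arc O x y.
Proof. by rewrite [LHS]inE /= !liftK. Qed.

Lemma extend_to_max k O x :
  has_arc (extend k O) (lift d x) d = (d <= x) && (clique_rank O x < n - k).
Proof. by rewrite [LHS]inE /= liftK unlift_none. Qed.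

Lemma extend_from_max k O y :
  has_arc (extend k O) d (lift d y) = (d <= y) && (n - k <= clique_rank O y).
Proof. by rewrite [LHS]inE /= liftK unlift_none. Qed.

Lemma extend_max k O : has_arc (extend k O) d d = false.
Proof. by rewrite [LHS]inE /= unlift_none. Qed.

Lemma restrictE Q x y : has_arc (restrict Q) x y = has_arc Q (lift d x) (lift d y).
Proof. by rewrite [LHS]inE. Qed.

Section CliqueRank.

Variable O : {set 'I_n * 'I_n}.
Hypotheses (O_or : is_orientation G' O) (O_ac : acyclic O).

(** An acyclic tournament is transitive: along an arc the predecessors of the source are among those
    of the target, which has the source in addition. The converse applies this to the opposite
    arc. *)
Lemma clique_rank_lt x y : d <= x -> d <= y ->
  has_arc O x y = (clique_rank O x < clique_rank O y).
Proof.
have [/orientationP[H1 _] [h hO]] := (O_or, (acyclic_height O).1 O_ac).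
have mono a b : d <= a -> d <= b -> has_arc O a b -> clique_rank O a < clique_rank O b.
  move=> da db ab; apply: proper_card; apply/properP; split.
    apply/subsetP => z; rewrite !inE => /andP[dz za]; rewrite dz /=.
    have hzb : h z < h b by rewrite (ltn_trans (hO _ _ za)) ?hO.
    have zb : z != b by apply: contraTneq hzb => ->; rewrite ltnn.
    rewrite (H1 _ _ (edge_clique dz db zb)); apply: contraL hzb => /hO bz.
    by rewrite -leqNgt ltnW.
  exists a; rewrite inE ?da ?ab //=; apply/negP => /hO.
  by rewrite ltnn.
move=> dx dy; apply/idP/idP => [|lt]; first exact: mono.
have xy : x != y by apply: contraTneq lt => ->; rewrite ltnn.
rewrite (H1 _ _ (edge_clique dx dy xy)); apply: contraL lt => /(mono _ _ dy dx) yx.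
by rewrite -leqNgt ltnW.
Qed.

Lemma clique_rank_inj x y : d <= x -> d <= y -> clique_rank O x = clique_rank O y -> x = y.
Proof.
move=> dx dy E; apply/eqP; apply: contraTT (O_or) => xy.
apply/negP => /orientationP[/(_ _ _ (edge_clique dx dy xy)) + _].
by rewrite !clique_rank_lt // E ltnn.
Qed.

Lemma card_clique : #|[set x : 'I_n | d <= x]| = n - d.
Proof.
rewrite -sum_geq -sum1_card big_mkcond /=; apply: eq_bigr => x _.
by rewrite inE; case: (d <= x).
Qed.

Lemma clique_rank_bound x : d <= x -> clique_rank O x < n - d.
Proof.
move=> dx; rewrite -card_clique; apply: proper_card; apply/properP; split.
  by apply/subsetP => y; rewrite !inE => /andP[].
exists x; first by rewrite inE.
by rewrite inE dx clique_rank_lt // ltnn.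
Qed.

Lemma card_clique_rank_range (A : {set 'I_n}) lo hi :
  (forall x, x \in A -> (d <= x) && (lo <= clique_rank O x < hi)) -> #|A| <= hi - lo.
Proof.
move=> H; rewrite cardE -(size_map (clique_rank O)) -(size_iota lo (hi - lo)).
apply: uniq_leq_size => [|m /mapP[x]].
  rewrite map_inj_in_uniq ?enum_uniq // => x y; rewrite !mem_enum.
  by move=> /H/andP[dx _] /H/andP[dy _]; apply: clique_rank_inj.
by rewrite mem_enum => /H/andP[_ ?] ->; rewrite mem_iota; lia.
Qed.

(** Ranks being distinct, at most [m] vertices have rank below [m] and at most [n - d - m] have a
    larger one; the clique has [n - d] vertices, so both bounds are attained. *)
Lemma card_clique_rank_lt m : m <= n - d ->
  #|[set x : 'I_n | (d <= x) && (clique_rank O x < m)]| = m.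
Proof.
move=> mn; set A := [set x | _].
have A_le : #|A| <= m - 0 by apply: card_clique_rank_range => x; rewrite inE.
have B_le : #|[set x : 'I_n | d <= x] :\: A| <= n - d - m.
  apply: card_clique_rank_range => x; rewrite !inE => /andP[+ dx]; rewrite dx /= -leqNgt => -> /=.
  exact: clique_rank_bound.
have AN : A \subset [set x : 'I_n | d <= x] by apply/subsetP => x; rewrite !inE => /andP[].
have := cardsID A [set x : 'I_n | d <= x].
by rewrite (setIidPr AN) card_clique; lia.
Qed.

Variable k : 'I_n.+1.
Hypothesis dk : d <= k.

Lemma extend_orientation : is_orientation G (extend k O).
Proof.
have /orientationP[H1 H2] := O_or.
apply/orientationP; split=> i j; case: (unliftP d i) => [x|] ->; case: (unliftP d j) => [y|] ->.
- by rewrite edge_lift !extend_lift; apply: H1.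
- rewrite edge_max_sym extend_to_max extend_from_max => -> /=.
  by rewrite -ltnNge.
- rewrite edge_max extend_to_max extend_from_max => -> /=.
  by rewrite -leqNgt.
- by rewrite inversion_graph_irr.
- by rewrite edge_lift !extend_lift; apply: H2.
- by rewrite edge_max_sym extend_to_max => /andP[].
- by rewrite edge_max extend_from_max => /andP[].
- by rewrite extend_max.
Qed.

Lemma extend_acyclic : acyclic (extend k O).
Proof.
have [h hO] := (acyclic_height O).1 O_ac; apply/acyclic_height.
(* Old vertices get odd heights and [d] an even one, just above its highest predecessor; this is
   still below every successor, since each predecessor has an arc to it. *)
pose hd := \max_(x : 'I_n | (d <= x) && (clique_rank O x < n - k)) (h x).+1.
exists (fun i => if unlift d i is Some x then (h x).*2.+1 else hd.*2) => i j.
case: (unliftP d i) => [x|] ->; case: (unliftP d j) => [y|] ->.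
- by rewrite extend_lift => /hO; rewrite !ltnS ltn_double.
- rewrite extend_to_max => xlow; rewrite -doubleS leq_double.
  exact: (@leq_bigmax_cond _ _ (fun x : 'I_n => (h x).+1)).
- rewrite extend_from_max => /andP[dy yhigh]; rewrite ltnS leq_double.
  apply/bigmax_leqP => x /andP[dx xlow]; apply: hO.
  by rewrite clique_rank_lt // (leq_trans xlow).
- by rewrite extend_max.
Qed.

Lemma max_preds_extend : #|max_preds (extend k O)| = n - k.
Proof.
rewrite -[RHS](card_clique_rank_lt (m := n - k)) ?leq_sub2l //.
by apply: eq_card => x; rewrite !inE extend_to_max.
Qed.

Lemma split_extend : split_orientation (extend k O) = (k, O).
Proof.
rewrite /split_orientation max_preds_extend subKn -1?ltnS // inord_val; congr pair.
by apply/setP => -[x y]; have := extend_lift k O x y; rewrite -restrictE.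
Qed.

(** The neighbours of [d] are all larger, so the new descents are exactly the arcs into [d]. *)
Lemma des_extend : des (extend k O) = des O + (n - k).
Proof.
have desE m (Q : {set 'I_m * 'I_m}) :
  des Q = \sum_(x < m) \sum_(y < m) (has_arc Q x y && (y < x)).
  by rewrite des_sum pair_big.
rewrite !desE (bigD1_ord d) //= [X in X + _]big1 => [|j _]; last first.
  case: (unliftP d j) => [y|] ->; rewrite ?extend_max //.
  rewrite extend_from_max lift_lt; case: (leqP d y) => // dy.
  by rewrite andbF.
rewrite add0n -max_preds_extend -sum1_card [X in _ = _ + X]big_mkcond -big_split /=.
apply: eq_bigr => x _; rewrite (bigD1_ord d) //= addnC; congr (_ + _).
  by apply: eq_bigr => y _; rewrite extend_lift ltn_lift2.
rewrite inE lift_gt extend_to_max; case: (d <= x); rewrite ?andbF //= andbT.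
by case: (_ < _).
Qed.

End CliqueRank.

Section Split.

Variable Q : {set 'I_n.+1 * 'I_n.+1}.
Hypotheses (Q_or : is_orientation G Q) (Q_ac : acyclic Q).

Lemma restrict_orientation : is_orientation G' (restrict Q).
Proof.
have /orientationP[H1 H2] := Q_or.
by apply/orientationP; split=> x y; rewrite !restrictE -edge_lift; [apply: H1 | apply: H2].
Qed.

Lemma restrict_acyclic : acyclic (restrict Q).
Proof.
have [h hQ] := (acyclic_height Q).1 Q_ac; apply/acyclic_height.
by exists (fun x => h (lift d x)) => x y; rewrite restrictE; apply: hQ.
Qed.

Lemma max_preds_sub x : x \in max_preds Q -> d <= x.
Proof.
by have /orientationP[_ H2] := Q_or; rewrite inE => /H2; rewrite edge_max_sym.
Qed.

(** By acyclicity, whatever precedes a predecessor of [d] in the clique also precedes [d]: the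
    predecessors of [d] form an initial segment of the total order. *)
Lemma max_preds_rank x : d <= x ->
  (x \in max_preds Q) = (clique_rank (restrict Q) x < #|max_preds Q|).
Proof.
have [/orientationP[H1 _] [h hQ]] := (Q_or, (acyclic_height Q).1 Q_ac).
move=> dx.
have down y z : d <= y -> has_arc Q (lift d y) (lift d z) -> z \in max_preds Q ->
  y \in max_preds Q.
  rewrite !inE => dy /hQ yz /hQ zd; rewrite H1 ?edge_max_sym //.
  by apply/negP => /hQ; rewrite ltnNge ltnW // (ltn_trans yz).
apply/idP/idP => [xM|].
  apply: proper_card; apply/properP; split.
    by apply/subsetP => y; rewrite inE restrictE => /andP[dy yx]; apply: down xM.
  exists x => //; rewrite inE restrictE; apply/negP => /andP[_ /hQ].
  by rewrite ltnn.
apply: contraLR => xM; rewrite -leqNgt; apply: subset_leq_card.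
apply/subsetP => y yM; have dy := max_preds_sub yM; rewrite inE dy restrictE H1.
  by apply: contra xM => xy; apply: down yM.
by rewrite edge_lift edge_clique //; apply: contraTneq yM => ->.
Qed.

Lemma max_preds_card : #|max_preds Q| <= n - d.
Proof.
rewrite -card_clique; apply: subset_leq_card.
by apply/subsetP => x /max_preds_sub; rewrite inE.
Qed.

Lemma split_orientationK :
  extend (split_orientation Q).1 (split_orientation Q).2 = Q.
Proof.
have /orientationP[H1 H2] := Q_or.
have E : n - (inord (n - #|max_preds Q|) : 'I_n.+1) = #|max_preds Q|.
  rewrite inordK ?ltnS ?leq_subr // subKn //.
  by rewrite (leq_trans max_preds_card) ?leq_subr.
apply/setP => -[i j]; rewrite -[LHS]/(has_arc _ i j) -[RHS]/(has_arc _ i j) /=.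
case: (unliftP d i) => [x|] ->; case: (unliftP d j) => [y|] ->.
- by rewrite extend_lift restrictE.
- rewrite extend_to_max E; case: (boolP (d <= x)) => dx /=.
    by rewrite -max_preds_rank // inE.
  by apply/esym/negP => /H2; rewrite edge_max_sym (negPf dx).
- rewrite extend_from_max E; case: (boolP (d <= y)) => dy /=.
    by rewrite H1 ?edge_max // leqNgt -max_preds_rank // inE.
  by apply/esym/negP => /H2; rewrite edge_max (negPf dy).
- by rewrite extend_max; apply/esym/negP => /H2; rewrite inversion_graph_irr.
Qed.

Lemma split_orientation_ge : d <= (split_orientation Q).1.
Proof.
rewrite /= inordK ?ltnS ?leq_subr //.
by rewrite -{1}(subKn (leq_ord d)) leq_sub2l // max_preds_card.
Qed.

End Split.

(** The sum is reindexed along the mutually inverse [extend] and [split_orientation]; inserting at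
    [k] adds [n - k] descents. *)
Lemma inversion_poly_insert_max :
  inversion_poly (insert_max d w)
  = ((\sum_(k < n.+1 | (d <= k)%N) 'X^(n - k)) * inversion_poly w)%R.
Proof.
rewrite /inversion_poly /acyclic_orientation_poly.
rewrite (reindex_onto (fun e => extend e.1 e.2) split_orientation) /=; last first.
  by move=> Q /andP[Q1 Q2]; apply: split_orientationK.
rewrite big_distrl /=; under [RHS]eq_bigr do rewrite big_distrr /=.
rewrite pair_big /=; apply: eq_big => [[k O]|[k O]] /=; last first.
  move=> /andP[/andP[Q1 Q2] /eqP E].
  have dk := split_orientation_ge Q1; have O1 := restrict_orientation Q1.
  have O2 := restrict_acyclic Q2; rewrite E /= in dk.
  have OE : restrict (extend k O) = O by case: E.
  rewrite OE in O1 O2.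
  by rewrite (des_extend O1 O2 dk) GRing.exprD GRing.mulrC.
apply/andP/andP => [[/andP[Q1 Q2] /eqP E]|[dk /andP[O1 O2]]].
  have dk := split_orientation_ge Q1; have O1 := restrict_orientation Q1.
  have O2 := restrict_acyclic Q2; rewrite E /= in dk.
  have OE : restrict (extend k O) = O by case: E.
  by rewrite OE in O1 O2; rewrite O1 O2.
by rewrite (split_extend O1 O2 dk) extend_orientation // extend_acyclic.
Qed.

End Decreasing.

End InsertMax.

(** * Permutations avoiding both patterns *)

Definition dec_after_max n (w : 'S_n.+1) : bool :=
  [forall i : 'I_n.+1, forall j : 'I_n.+1,
    ((w^-1)%g ord_max < i < j) ==> (w j < w i)].

(** Let [d] be the position of the maximum and [e] the last position. If both conditions fail, there
    are an ascent [i < j] to the right of [d] and an ascent [p < q] with values above [w e].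
    Avoiding 4231 gives [w i < w e] and [p < d], and then [p], [d], [i], [e] form 3412. *)
Lemma dec_after_max_or_inv n (w : 'S_n.+1) : ~ has3412 w -> ~ has4231 w ->
  dec_after_max w || dec_after_max w^-1%g.
Proof.
move=> n3412 n4231; apply/norP => -[].
set d := (w^-1)%g ord_max; have wd : w d = ord_max by rewrite permKV.
have lt_max (x : 'I_n.+1) : x != ord_max -> x < (ord_max : 'I_n.+1).
  by rewrite -val_eqE /=; have := ltn_ord x; lia.
have lt_d (x : 'I_n.+1) : x != d -> w x < w d.
  by move=> xd; rewrite wd lt_max // -wd (inj_eq perm_inj).
have neq_lt (x y : 'I_n.+1) : x < y -> x != y by move=> h; rewrite -val_eqE /= neq_ltn h.
case/forallPn => i /forallPn[j]; rewrite negb_imply -leqNgt => /andP[/andP[di ij] wij].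
have {}wij : w i < w j.
  by rewrite ltn_neqAle wij val_eqE (inj_eq perm_inj) neq_lt.
case/forallPn => p' /forallPn[q']; rewrite negb_imply -leqNgt invgK.
pose e := (ord_max : 'I_n.+1).
(* [p'] and [q'] are values of [w]; [p] and [q] are their positions. *)
rewrite -(permKV w p') -(permKV w q') !permK; set p := (w^-1)%g p'; set q := (w^-1)%g q'.
move=> /andP[/andP[ep wpq] pq].
have {}pq : p < q.
  by rewrite ltn_neqAle pq andbT; apply: contraTneq wpq => /val_inj->; rewrite ltnn.
have i_max : i < e by apply: lt_max; rewrite -val_eqE /=; have := ltn_ord j; lia.
have wd_gt (x : 'I_n.+1) : d < x -> w x < w d by move=> dx; rewrite lt_d // eq_sym neq_lt.
(* Any ascent right of the maximum and above the last value gives 4231. *)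
have no_asc (x y : 'I_n.+1) : d < x -> x < y -> w e < w x -> ~ w x < w y.
  move=> dx xy ex wxy; apply: n4231; exists d, x, y, e; split; split=> //.
    apply: lt_max; apply: contraTneq wxy => ->.
    by rewrite -leqNgt ltnW.
  by apply: wd_gt; apply: ltn_trans xy.
have wie : w i < w e.
  case: (ltngtP (w i) (w e)) => // [wei|/val_inj/perm_inj ie]; first by case: (no_asc i j).
  by move: i_max; rewrite ie ltnn.
have pd : p < d.
  case: (ltngtP p d) => // [dp|/val_inj pd]; first by case: (no_asc p q).
  by move: wpq; rewrite pd wd; have := ltn_ord (w q); rewrite /= ltnS => /leq_ltn_trans h /h; rewrite ltnn.
apply: n3412; exists p, d, i, e; split; split=> //.
by apply: lt_d; apply: neq_lt.
Qed.

Lemma has3412_insert_max n (d : 'I_n.+1) (w : 'S_n) : has3412 w -> has3412 (insert_max d w).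
Proof.
move=> [a [b [c [e [pos val]]]]]; exists (lift d a), (lift d b), (lift d c), (lift d e).
by rewrite !ltn_lift2 !insert_max_lift.
Qed.

Lemma has4231_insert_max n (d : 'I_n.+1) (w : 'S_n) : has4231 w -> has4231 (insert_max d w).
Proof.
move=> [a [b [c [e [pos val]]]]]; exists (lift d a), (lift d b), (lift d c), (lift d e).
by rewrite !ltn_lift2 !insert_max_lift.
Qed.

Lemma poincare_eq_inversion_poly n (w : 'S_n) : ~ has3412 w -> ~ has4231 w ->
  poincare w = inversion_poly w.
Proof.
elim: n w => [w _ _|n IH w n3412 n4231].
  have all_eq (u : 'S_0) : u = w by apply/permP => -[].
  have noarc (O : {set 'I_0 * 'I_0}) : O = set0 by apply/setP => -[[]].
  rewrite /poincare (big_pred1 w) => [|u]; last by rewrite (all_eq u) bruhat_le_refl /= eqxx.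
  rewrite /inversion_poly /acyclic_orientation_poly (big_pred1 set0) => [|O].
    by rewrite /ell /des (noarc (inversions w)) (noarc [set a in _ | _]).
  by rewrite (noarc O) /= eqxx; apply/andP; split; apply/forallP => -[].
(* Inversion preserves both polynomials and the avoidance of both patterns. *)
wlog dec : w n3412 n4231 / dec_after_max w => [H|].
  have /orP[|dec] := dec_after_max_or_inv n3412 n4231; first exact: H.
  rewrite -poincare_inv -inversion_poly_inv; apply: H => //.
    by move/has3412_inv.
  by move/has4231_inv.
have [g _ gK] := insert_max_bij n; move: (gK w); case: (g w) => d v /= wE.
rewrite -{}wE in n3412 n4231 dec *.
have v_dec (a b : 'I_n) : d <= a -> a < b -> v b < v a.
  move=> da ab; have /forallP/(_ (lift d a))/forallP/(_ (lift d b)) := dec.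
  rewrite -[in X in X < _](insert_max_id d v) permK lift_gt ltn_lift2 da ab /=.
  by rewrite !insert_max_lift.
rewrite poincare_insert_max // inversion_poly_insert_max // IH //.
  by move/(has3412_insert_max d).
by move/(has4231_insert_max d).
Qed.

Theorem theorem4p1 (n : nat) (hn : (0 < n)%N) (w : 'S_n) :
  poincare w = inversion_poly w <->
  avoids_pattern w p3412 /\ avoids_pattern w p4231.
Proof.
rewrite /avoids_pattern; split=> [E|[n3412 n4231]].
  by split=> [/contains3412|/contains4231] H;
    apply: (poincare_neq_inversion_poly _ E); [left|right].
by apply: poincare_eq_inversion_poly => [/contains3412|/contains4231].
Qed.
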